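(* Let $A \in M_{2m}(\mathbb{C})$ be $J_{2m}$-normal and let $\varepsilon > 0$ be given. Then there exists some $J_{2m}$-normal matrix $\hat{A} \in M_{2m}(\mathbb{C})$ with $2m$ distinct eigenvalues such that $\Vert A - \hat{A} \Vert_2 < \varepsilon$.
   Context: $M_{2m}(\mathbb{C})$ is the set of complex $2m\times 2m$ matrices, $^H$ denotes conjugate transpose, and $\Vert\cdot\Vert_2$ is the spectral norm. $J_{2m} = \begin{bmatrix} 0 & I_m \\ -I_m & 0\end{bmatrix}$. For $A\in M_{2m}(\mathbb{C})$ put $A^\star := J_{2m}^{-1}A^HJ_{2m}$. $A$ is $J_{2m}$-normal if $AA^\star=A^\star A$. *)

(* Defs.v *)
(* The complex field is R[i] for R : realType. *)
From HB Require Import structures.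
From mathcomp Require Import all_boot all_order all_algebra.
From mathcomp Require Import all_classical all_reals.
From mathcomp Require Import complex.

Set Implicit Arguments.
Unset Strict Implicit.
Unset Printing Implicit Defensive.

Import Order.TTheory GRing.Theory Num.Theory.
Local Open Scope classical_set_scope.
Local Open Scope ring_scope.
Local Open Scope sesquilinear_scope.

(* The size 2m is written m + m, so that J is literally a block matrix. *)
Definition Jmx (R : realType) (m : nat) : 'M[R[i]]_(m + m) :=
  block_mx 0 1%:M (- 1%:M) 0.

(* M ^t* is the conjugate transpose of M. *)
Definition Jstar (R : realType) (m : nat) (A : 'M[R[i]]_(m + m)) :
    'M[R[i]]_(m + m) :=
  invmx (Jmx R m) *m A ^t* *m Jmx R m.

Definition Jnormal (R : realType) (m : nat) (A : 'M[R[i]]_(m + m)) : Prop :=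
  A *m Jstar A = Jstar A *m A.

Definition norm2 (R : realType) (n : nat) (x : 'cV[R[i]]_n) : R :=
  Num.sqrt (\sum_(i < n) Normc.normc (x i 0) ^+ 2).

(* The set is bounded (finite dimension), so this sup is the genuine one; for
   n = 0 the set is empty and the value is 0. *)
Definition spectral_norm (R : realType) (n : nat) (A : 'M[R[i]]_n) : R :=
  sup [set norm2 (A *m x) | x in [set x : 'cV[R[i]]_n | norm2 x = 1]].

(* The set of eigenvalues of the n x n matrix A has exactly n elements; the
   library's eigenvalues are those of the action on row vectors, which are the
   same scalars as for column vectors. *)
Definition all_distinct_eigenvalues (R : realType) (n : nat)
    (A : 'M[R[i]]_n) : Prop :=
  exists s : seq R[i],
    [/\ uniq s, size s = n & forall a : R[i], (a \in s) = eigenvalue A a].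

(* Main.v *)
Require Import Defs.
From mathcomp Require Import all_boot all_order all_algebra.
From mathcomp Require Import all_classical all_reals.
From mathcomp Require Import complex separable.
Import Order.TTheory GRing.Theory Num.Theory.
Local Open Scope ring_scope.
Set Implicit Arguments.
Unset Strict Implicit.
Unset Printing Implicit Defensive.

(** Write W^* for the J-adjoint. The map W |-> W^* is a conjugate-linear
    anti-automorphism of order two that fixes some matrix with distinct
    eigenvalues, and this is all that the argument asks of it. If W is selfadjoint then every polynomial g(W) is normal, because
    g(W)^* commutes with W. So it suffices to approach A by matrices g(W) with
    W selfadjoint and g(W) having distinct eigenvalues.

    Split A = S - (i/2) T with S and T selfadjoint; normality means that S and
    T commute. As in the theorem of Motzkin and Taussky on commuting pairs, the
    first step is to move S inside the commutant of T so that T becomes a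
    polynomial in S. For that one needs a cyclic (nonderogatory) selfadjoint Z
    that commutes with T:
    - over the complex numbers some cyclic N commutes with T
      ([exists_cyclic_commutant], by a cyclic decomposition of T);
    - N = X - (i/2) Y with X and Y selfadjoint and commuting with T. Cyclicity
      of X + t Y with respect to a fixed vector is the nonvanishing of a
      polynomial in t, which is not zero at t = -i/2, so it is not zero at some
      real t ([exists_cyclic_selfadjoint_commutant]).
    No canonical form for indefinite inner products enters: all genericity
    conditions are polynomial, so they may be met first over the complex
    numbers and then over the reals.

    Three moves along segments, each by an arbitrarily small real parameter,
    then give the result ([star_normal_approx]):
    - from S towards Z: W = S + t (Z - S) is cyclic, hence T = q(W) and
      A + t (Z - S) = g(W) with g = X - (i/2) q;
    - from W towards a selfadjoint D with distinct eigenvalues, inside g: the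
      new W' has distinct eigenvalues and g(W') is close to g(W);
    - from g(W') towards W': the result is still a polynomial in W', and now
      has distinct eigenvalues itself.
    In each move the wanted property is the nonvanishing of a polynomial in
    the parameter that is not zero at the far end, so it holds for arbitrarily
    small parameters ([exists_small_nonroot]). *)

(** * Polynomials of matrices and generic values *)

Lemma horner_mx_intertwine (R : comNzRingType) (n : nat) (X A B : 'M[R]_n.+1)
    (p : {poly R}) :
  X *m A = B *m X -> X *m horner_mx A p = horner_mx B p *m X.
Proof.
move=> XA; elim/poly_ind: p => [|p c IH]; first by rewrite !rmorph0 mulmx0 mul0mx.
rewrite !rmorphD !rmorphM /= !horner_mx_X !horner_mx_C mulmxDr mulmxDl.
by rewrite -!mulmxE mulmxA IH -!mulmxA XA scalar_mxC.
Qed.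

Lemma trmx_horner_mx (R : comNzRingType) (n : nat) (A : 'M[R]_n.+1)
    (p : {poly R}) :
  (horner_mx A p)^T = horner_mx A^T p.
Proof.
elim/poly_ind: p => [|p c IH]; first by rewrite !rmorph0 trmx0.
rewrite !rmorphD !rmorphM /= !horner_mx_X !horner_mx_C linearD /= tr_scalar_mx.
rewrite -!mulmxE trmx_mul IH; congr (_ + _).
exact: comm_mx_horner.
Qed.

Lemma horner_mx_subC (R : comNzRingType) (n : nat) (A : 'M[R]_n.+1)
    (c : R) (p : {poly R}) :
  horner_mx (A - c%:M) p = horner_mx A (p \Po ('X - c%:P)).
Proof.
elim/poly_ind: p => [|p a IH]; first by rewrite comp_poly0 !rmorph0.
rewrite comp_poly_MXaddC !rmorphD !rmorphM /= rmorphB /=.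
by rewrite !horner_mx_X !horner_mx_C IH.
Qed.

Lemma exists_nonroot (F : idomainType) (p : {poly F}) (f : nat -> F) :
  injective f -> p != 0 -> exists k, ~~ root p (f k).
Proof.
move=> finj p0; apply: contrapT => /forallNP allr.
have := max_poly_roots p0 (rs := [seq f i | i <- iota 0 (size p)]).
rewrite size_map size_iota ltnn map_inj_uniq ?iota_uniq // => H.
suff: false by []. apply: H => //.
by apply/allP => x /mapP[k _ ->]; apply: contraPT (allr k) => ->; case.
Qed.

(** A common root of the shifted p and of q forces the shift to be a
    difference of a root of p and a root of q: finitely many values. *)
Lemma exists_coprime_shift (F : numClosedFieldType) (p q : {poly F}) :
  p != 0 -> q != 0 -> exists c, coprimep (p \Po ('X + c%:P)) q.
Proof.
move=> p0 q0.
have [r Dp] := closed_field_poly_normal p.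
have [s Dq] := closed_field_poly_normal q.
have rP x : root p x = (x \in r).
  by rewrite Dp rootZ ?lead_coef_eq0 // root_prod_XsubC.
have sP x : root q x = (x \in s).
  by rewrite Dq rootZ ?lead_coef_eq0 // root_prod_XsubC.
pose bad := \prod_(z <- [seq x - y | x <- r, y <- s]) ('X - z%:P).
have [k] : exists k : nat, ~~ root bad k%:R.
  apply: exists_nonroot; last by rewrite monic_neq0 // monic_prod_XsubC.
  by apply: mulrIn; rewrite oner_eq0.
rewrite root_prod_XsubC => kbad; exists k%:R.
apply: Pdiv.ClosedField.root_coprimep => x.
rewrite /root horner_comp hornerD hornerX hornerC -/(root p _) rP => xr.
rewrite -/(root q x) sP; apply: contra kbad => xs.
by apply/allpairsP; exists (x + k%:R, x); rewrite xr xs addrAC subrr add0r.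
Qed.

(** * Krylov matrices and cyclic vectors *)

Definition krylov (R : comNzRingType) (n : nat) (A : 'M[R]_n.+1)
    (v : 'rV[R]_n.+1) (d : nat) : 'M[R]_(d, n.+1) :=
  \matrix_(i < d) (v *m A ^+ i).

Lemma mul_krylov (R : comNzRingType) (n d : nat) (A : 'M[R]_n.+1)
    (v : 'rV[R]_n.+1) (x : 'rV[R]_d) :
  x *m krylov A v d = v *m horner_mx A (rVpoly x).
Proof.
rewrite mulmx_sum_row [rVpoly x]poly_def rmorph_sum /= mulmx_sumr.
apply: eq_bigr => i _; rewrite rowK linearZ /= rmorphXn /= horner_mx_X.
rewrite -scalemxAr; congr (_ *: _); case: insubP => [j _ ij|]; last by rewrite ltn_ord.
by congr (x _ _); apply: val_inj.
Qed.

(** Linear independence of the rows v, v A, ..., v A^(d-1), stated through the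
    polynomial that has the coefficients of a dependency; this form transports
    between different matrices that act alike on v. *)
Definition krylov_free (F : fieldType) (n : nat) (A : 'M[F]_n.+1)
    (v : 'rV[F]_n.+1) (d : nat) : Prop :=
  forall p : {poly F}, (size p <= d)%N -> v *m horner_mx A p = 0 -> p = 0.

Lemma krylov_freeP (F : fieldType) (n d : nat) (A : 'M[F]_n.+1)
    (v : 'rV[F]_n.+1) :
  row_free (krylov A v d) <-> krylov_free A v d.
Proof.
split=> [/row_freeP[B KB] p sp vp|free].
  rewrite -(poly_rV_K sp) -[poly_rV p]mulmx1 -KB mulmxA mul_krylov.
  by rewrite (poly_rV_K sp) vp mul0mx raddf0.
rewrite -kermx_eq0; apply/eqP/row_matrixP => i; rewrite row0.
have /free : (size (rVpoly (row i (kermx (krylov A v d)))) <= d)%N.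
  exact: size_poly.
rewrite -mul_krylov -row_mul mulmx_ker row0 => /(_ erefl) H.
by rewrite -[LHS]rVpolyK H raddf0.
Qed.

(** The independent rows v A^i have a dual basis; u is its last vector. The
    linear form q |-> v q(A) u then reads off the coefficient of index d - 1,
    so the Hankel matrix of the v A^(i+j) u is anti-triangular with unit
    antidiagonal. *)
Lemma krylov_dual (F : fieldType) (n d : nat) (A : 'M[F]_n.+1)
    (v : 'rV[F]_n.+1) :
  krylov_free A v d ->
  exists u : 'cV_n.+1, forall q : {poly F}, (size q <= d)%N ->
    (v *m horner_mx A q *m u) 0 0 = q`_d.-1.
Proof.
move=> /krylov_freeP/row_freeP[B KB].
case: d B KB => [|d] B KB.
  exists 0 => q; rewrite size_poly_leq0 => /eqP->.
  by rewrite mulmx0 mxE coef0.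
exists (B *m delta_mx ord_max 0) => q sq.
rewrite -{1}(poly_rV_K sq) -mul_krylov mulmxA -(mulmxA (poly_rV q)) KB mulmx1.
by rewrite -colE !mxE.
Qed.

(** Nonsingularity of that Hankel matrix, without determinants: multiplying a
    nonzero p by the power of 'X that brings its size to d moves its leading
    coefficient to the place that u reads. *)
Lemma hankel_nondegenerate (F : fieldType) (n d : nat) (A : 'M[F]_n.+1)
    (v : 'rV[F]_n.+1) (u : 'cV[F]_n.+1) (p : {poly F}) :
  (forall q : {poly F}, (size q <= d)%N ->
    (v *m horner_mx A q *m u) 0 0 = q`_d.-1) ->
  (size p <= d)%N ->
  (forall j, (j < d)%N -> (v *m horner_mx A p *m (A ^+ j *m u)) 0 0 = 0) ->
  p = 0.
Proof.
move=> uP sp vp; apply/eqP/negPn/negP => p0.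
have sp0 : (0 < size p)%N by rewrite size_poly_gt0.
have := vp (d - size p)%N; rewrite ltn_subrL sp0 (leq_trans sp0 sp) => /(_ isT).
have sq : size (p * 'X^(d - size p)) = d by rewrite size_mulXn // subnK.
have := uP (p * 'X^(d - size p)); rewrite sq leqnn => /(_ isT).
rewrite rmorphM rmorphXn /= horner_mx_X -mulmxE !mulmxA => -> H.
by move: p0; rewrite -lead_coef_eq0 -(lead_coef_Mmonic p (monicXn _ (d - size p)))
  lead_coefE sq H eqxx.
Qed.

Lemma hankel_krylov_free (F : fieldType) (n d : nat) (A : 'M[F]_n.+1)
    (v : 'rV[F]_n.+1) (u : 'cV[F]_n.+1) :
  (forall q : {poly F}, (size q <= d)%N ->
    (v *m horner_mx A q *m u) 0 0 = q`_d.-1) ->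
  krylov_free A v d.
Proof.
move=> uP p sp vp; apply: (hankel_nondegenerate uP sp) => j _.
by rewrite vp mul0mx mxE.
Qed.

Lemma krylov_annihilator (F : fieldType) (n d : nat) (A : 'M[F]_n.+1)
    (v : 'rV[F]_n.+1) :
  krylov_free A v d -> ~ krylov_free A v d.+1 ->
  exists2 p : {poly F}, size p = d.+1 & v *m horner_mx A p = 0.
Proof.
move=> free nfree.
have [p] : exists p : {poly F},
    ~ ((size p <= d.+1)%N -> v *m horner_mx A p = 0 -> p = 0).
  exact/existsNP.
move=> /not_implyP[sp /not_implyP[vp p0]]; exists p => //.
apply/eqP; rewrite eqn_leq sp ltnNge; apply/negP => /free.
by move/(_ vp).
Qed.

Lemma horner_modp_annihilator (F : fieldType) (n : nat) (A : 'M[F]_n.+1)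
    (v : 'rV[F]_n.+1) (p q : {poly F}) :
  v *m horner_mx A p = 0 ->
  v *m horner_mx A q = v *m horner_mx A (q %% p).
Proof.
move=> vp; rewrite [in LHS](divp_eq q p) mulrC rmorphD rmorphM /= mulmxDr.
by rewrite -mulmxE mulmxA vp mul0mx add0r.
Qed.

Lemma krylov_annihilator_dvdp (F : fieldType) (n d : nat) (A : 'M[F]_n.+1)
    (v : 'rV[F]_n.+1) (p q : {poly F}) :
  krylov_free A v d -> size p = d.+1 -> v *m horner_mx A p = 0 ->
  v *m horner_mx A q = 0 -> p %| q.
Proof.
move=> free sp vp vq; apply/modp_eq0P/free; last by rewrite -horner_modp_annihilator.
by rewrite -ltnS -sp ltn_modp -size_poly_gt0 sp.
Qed.

Lemma sub_krylov (F : fieldType) (n d : nat) (A : 'M[F]_n.+1)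
    (v : 'rV[F]_n.+1) (p q : {poly F}) :
  size p = d.+1 -> v *m horner_mx A p = 0 ->
  (v *m horner_mx A q <= krylov A v d)%MS.
Proof.
move=> sp vp; rewrite (horner_modp_annihilator q vp).
have sq : (size (q %% p)%R <= d)%N.
  by rewrite -ltnS -sp ltn_modp -size_poly_gt0 sp.
by rewrite -(poly_rV_K sq) -mul_krylov submxMl.
Qed.

Lemma stable_krylov (F : fieldType) (n d : nat) (A : 'M[F]_n.+1)
    (v : 'rV[F]_n.+1) (p : {poly F}) :
  size p = d.+1 -> v *m horner_mx A p = 0 ->
  (krylov A v d *m A <= krylov A v d)%MS.
Proof.
move=> sp vp; apply/row_subP => i; rewrite row_mul rowK -mulmxA.
have -> : A ^+ i *m A = horner_mx A 'X^(i.+1).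
  by rewrite rmorphXn /= horner_mx_X exprSr.
exact: sub_krylov sp vp.
Qed.

(** When v and u span cyclic spaces of the same dimension d, for A acting on
    rows and on columns, and are dual in the Hankel sense, the row space K of v
    and the common kernel of the column space C of u are complementary and both
    stable under A. The matrix C (K C)^-1 K is the projection on the first along
    the second. *)
Lemma cyclic_projection (F : fieldType) (n d : nat) (A : 'M[F]_n.+1)
    (v : 'rV[F]_n.+1) (u : 'cV[F]_n.+1) (p q : {poly F}) :
  (forall r : {poly F}, (size r <= d)%N ->
    (v *m horner_mx A r *m u) 0 0 = r`_d.-1) ->
  size p = d.+1 -> v *m horner_mx A p = 0 ->
  size q = d.+1 -> u^T *m horner_mx A^T q = 0 ->
  exists B : 'M_d, let P := (krylov A^T u^T d)^T *m B *m krylov A v d in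
    [/\ P *m P = P, P *m A = A *m P & v *m P = v].
Proof.
move=> uP sp vp sq uq; set K := krylov A v d; set C := _^T.
have Hunit : K *m C \in unitmx.
  rewrite -row_free_unit -kermx_eq0; apply/eqP/row_matrixP => i; rewrite row0.
  set x := row i _; have xH : x *m (K *m C) = 0 by rewrite -row_mul mulmx_ker row0.
  apply: (can_inj rVpolyK); rewrite raddf0.
  apply: (hankel_nondegenerate uP); first exact: size_poly.
  move=> j jd; rewrite -mul_krylov -/K.
  have -> : A ^+ j *m u = col (Ordinal jd) C.
    rewrite -tr_row rowK /= trmx_mul trmxK; congr (_ *m _).
    by rewrite -[A^T](horner_mx_X) -rmorphXn /= -trmx_horner_mx trmxK
      rmorphXn /= horner_mx_X.
  by rewrite colE mulmxA -(mulmxA x) xH mul0mx mxE.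
exists (invmx (K *m C)) => P.
have KP : K *m P = K by rewrite /P !mulmxA mulmxV // mul1mx.
have PC : P *m C = C by rewrite /P -!mulmxA mulVmx // mulmx1.
have /submxP[X KA] := stable_krylov sp vp; rewrite -/K in KA.
have /submxP[Y] := stable_krylov sq uq.
move/(congr1 trmx); rewrite !trmx_mul trmxK -/C => AC.
split.
- by rewrite {1}/P -mulmxA KP.
- transitivity (P *m A *m P).
    by rewrite {1 2}/P -!mulmxA (mulmxA K) KA -!mulmxA KP.
  by rewrite {2}/P !mulmxA -(mulmxA P A C) AC mulmxA PC -AC.
have := sub_krylov 1 sp vp; rewrite rmorph1 mulmx1 => /submxP[x ->].
by rewrite -mulmxA KP.
Qed.

(** * A cyclic matrix in the commutant of a given matrix *)

Lemma krylov_absorb (F : fieldType) (n d : nat) (A E : 'M[F]_n.+1)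
    (v : 'rV[F]_n.+1) :
  E *m A = A *m E -> v *m E = v -> krylov A v d *m E = krylov A v d.
Proof.
move=> EA vE; apply/row_matrixP => i; rewrite row_mul rowK -mulmxA.
have -> : A ^+ i *m E = E *m A ^+ i.
  by rewrite -{1 2}(horner_mx_X A) -!rmorphXn /=; apply/esym/comm_mx_horner.
by rewrite mulmxA vE.
Qed.

Lemma krylov_free_rank (F : fieldType) (n d : nat) (A E : 'M[F]_n.+1)
    (v : 'rV[F]_n.+1) :
  E *m A = A *m E -> v *m E = v -> krylov_free A v d -> (d <= \rank E)%N.
Proof.
move=> EA vE /krylov_freeP/eqP <-; rewrite -(krylov_absorb d EA vE).
exact: mxrankM_maxr.
Qed.

Lemma krylov_free_maximal (F : fieldType) (n : nat) (A E : 'M[F]_n.+1) :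
  E *m A = A *m E ->
  exists d (v : 'rV[F]_n.+1), [/\ v *m E = v, krylov_free A v d &
    forall w : 'rV[F]_n.+1, w *m E = w -> ~ krylov_free A w d.+1].
Proof.
move=> EA.
pose Q d := `[< exists2 v : 'rV[F]_n.+1, v *m E = v & krylov_free A v d >].
have Q0 : exists d, Q d.
  exists 0%N; apply/asboolP; exists 0; first by rewrite mul0mx.
  by move=> p; rewrite size_poly_leq0 => /eqP.
have Qub d : Q d -> (d <= \rank E)%N.
  by move=> /asboolP[v vE]; apply: krylov_free_rank.
case: (ex_maxnP Q0 Qub) => d /asboolP[v vE free] dmax.
exists d, v; split=> // w wE wfree.
by have /dmax : Q d.+1 by [apply/asboolP; exists w]; rewrite ltnn.
Qed.

(** Cyclic decomposition, by induction on the rank of an idempotent E that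
    commutes with A; working with idempotents instead of restrictions keeps all
    matrices of the same size. Among the vectors of the image of E choose v with
    the longest free Krylov sequence, and let P be the projection on the cyclic
    space of v. By induction E - P carries a cyclic N2. Replacing A by A - c on
    the image of P leaves v cyclic and, for a suitable c, makes the annihilators
    of the two parts coprime; then the sum of the two vectors is cyclic for
    (A - c) P + N2. *)
Lemma exists_cyclic_commutant_idempotent (F : numClosedFieldType) (n : nat)
    (A E : 'M[F]_n.+1) :
  E *m E = E -> E *m A = A *m E ->
  exists (N : 'M[F]_n.+1) (v : 'rV[F]_n.+1),
    [/\ N *m A = A *m N, E *m N = N, N *m E = N, v *m E = v
      & krylov_free N v (\rank E)].
Proof.
have [r] := ubnP (\rank E); elim: r => // r IHr in E *.
rewrite ltnS => rE EE EA.
have [E0|E_neq0] := eqVneq E 0.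
  exists 0, 0; rewrite E0 !(mul0mx, mulmx0) mxrank0; split=> // p.
  by rewrite size_poly_leq0 => /eqP.
have [d [v [vE free vmax]]] := krylov_free_maximal EA.
have [y yP] := krylov_dual free.
have Ehorner (w : 'rV[F]_n.+1) (q : {poly F}) :
    w *m E = w -> w *m horner_mx A q *m E = w *m horner_mx A q.
  by move=> wE; rewrite -mulmxA -(comm_mx_horner q EA) mulmxA wE.
pose u := E *m y.
have Eu : E *m u = u by rewrite mulmxA EE.
have uP (q : {poly F}) : (size q <= d)%N ->
    (v *m horner_mx A q *m u) 0 0 = q`_d.-1.
  by move=> sq; rewrite /u mulmxA Ehorner // yP.
have [p sp vp] := krylov_annihilator free (vmax v vE).
have uP' (q : {poly F}) : (size q <= d)%N ->
    (u^T *m horner_mx A^T q *m v^T) 0 0 = q`_d.-1.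
  move=> sq; rewrite -(uP _ sq) -trmx_horner_mx -trmx_mul -trmx_mul mxE.
  by rewrite mulmxA.
(* A longer free sequence for u would, by duality, give a vector of the image
   of E with a free sequence longer than that of v. *)
have [q sq uq] : exists2 q : {poly F}, size q = d.+1 & u^T *m horner_mx A^T q = 0.
  have ufree0 : krylov_free A^T u^T d := hankel_krylov_free uP'.
  apply: (krylov_annihilator ufree0) => ufree.
  have [w wP] := krylov_dual ufree.
  apply: (vmax (w^T *m E)); first by rewrite -mulmxA EE.
  apply: (@hankel_krylov_free _ _ _ _ _ u) => g sg; rewrite -(wP _ sg).
  have -> : u^T *m horner_mx A^T g *m w = (w^T *m E *m horner_mx A g *m u)^T.
    rewrite -!mulmxA (mulmxA E) (comm_mx_horner g EA) -mulmxA Eu.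
    by rewrite !trmx_mul trmxK trmx_horner_mx mulmxA.
  by rewrite [RHS]mxE.
have [B] := cyclic_projection uP sp vp sq uq.
set P := _ *m _ => -[PP PA vP].
have PE : P *m E = P by rewrite /P -!mulmxA (krylov_absorb _ EA vE).
have EP : E *m P = P.
  rewrite /P !mulmxA; congr (_ *m _ *m _); apply: trmx_inj.
  rewrite trmx_mul trmxK; apply: krylov_absorb.
    by rewrite -!trmx_mul EA.
  by rewrite -trmx_mul /u mulmxA EE.
have PrE : (\rank P <= d)%N by rewrite (leq_trans (mxrankM_maxr _ _)) // rank_leq_row.
clearbody P; pose E' := E - P.
have E'E' : E' *m E' = E'.
  by rewrite mulmxBl !mulmxBr EE EP PE PP subrr subr0.
have E'A : E' *m A = A *m E' by rewrite mulmxBl mulmxBr EA PA.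
have EE' : E *m E' = E' by rewrite mulmxBr EE EP.
have E'E : E' *m E = E' by rewrite mulmxBl EE PE.
have PE' : P *m E' = 0 by rewrite mulmxBr PE PP subrr.
have E'P : E' *m P = 0 by rewrite mulmxBl EP PP subrr.
have d_gt0 : (0 < d)%N.
  rewrite lt0n; apply: contra E_neq0 => /eqP d0; move: vmax; rewrite d0 => vmax.
  apply/eqP/row_matrixP => i; rewrite row0.
  apply/eqP/negPn/negP => rowi0; apply: (vmax (row i E)).
    by rewrite -row_mul EE.
  move=> g sg; have [c ->] : exists c, g = c%:P by exists g`_0; apply: size1_polyC.
  rewrite horner_mx_C mul_mx_scalar => /eqP; rewrite scaler_eq0 (negPf rowi0) orbF.
  by move=> /eqP->.
have v_neq0 : v != 0.
  apply: contraTneq d_gt0 => v0; rewrite lt0n negbK; apply/eqP.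
  apply: contrapT => /eqP; rewrite -lt0n => d_gt0.
  have : (1 : {poly F}) = 0 by apply: free; rewrite ?size_poly1 // v0 mul0mx.
  by apply/eqP; rewrite oner_eq0.
have rE' : (\rank E' < \rank E)%N.
  have [le_rk eq_rk] := mxrank_leqif_sup (submxMl E' E); rewrite E'E in le_rk eq_rk.
  rewrite ltn_neqAle le_rk andbT eq_rk; apply: contra v_neq0 => /submxP[X EX].
  by rewrite -vP -vE EX -!mulmxA E'P !mulmx0.
have [N2 [v2 [N2A E'N2 N2E' v2E' free2]]] := IHr E' (leq_trans rE' rE) E'E' E'A.
have [p2 sp2 vp2] : exists2 p2 : {poly F}, size p2 = (\rank E').+1 &
    v2 *m horner_mx N2 p2 = 0.
  apply: (krylov_annihilator free2) => /(krylov_free_rank _ v2E').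
  by rewrite ltnn N2E' E'N2 => /(_ erefl).
(* 'X + c here corresponds to A - c below. *)
have [c pp2] : exists c, coprimep (p \Po ('X + c%:P)) p2.
  by apply: exists_coprime_shift; rewrite -size_poly_gt0 ?sp ?sp2.
pose A1 := A - c%:M; pose N := A1 *m P + N2.
have PA1 : P *m A1 = A1 *m P.
  by rewrite mulmxBl mulmxBr PA scalar_mxC.
have PN : P *m N = A1 *m P.
  by rewrite mulmxDr mulmxA PA1 -mulmxA PP -E'N2 mulmxA PE' mul0mx addr0.
have E'N : E' *m N = N2 *m E'.
  by rewrite mulmxDr -PA1 mulmxA E'P mul0mx add0r E'N2 N2E'.
exists N, (v + v2); split.
- rewrite /N mulmxDl mulmxDr N2A; congr (_ + _).
  rewrite -mulmxA PA !mulmxA; congr (_ *m _).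
  by rewrite mulmxBl mulmxBr scalar_mxC.
- by rewrite /N mulmxDr -PA1 mulmxA EP -{1}E'N2 mulmxA EE' E'N2.
- by rewrite /N mulmxDl -mulmxA PE -{1}N2E' -mulmxA E'E N2E'.
- by rewrite mulmxDl vE -{1}v2E' -mulmxA E'E v2E'.
(* P and E' separate g(N) into its two components, so both annihilators
   divide g, which is too short for their product. *)
move=> g sg; rewrite mulmxDl.
have -> : v *m horner_mx N g = v *m horner_mx A1 g *m P.
  by rewrite -{1}vP -mulmxA (horner_mx_intertwine g PN) mulmxA.
have -> : v2 *m horner_mx N g = v2 *m horner_mx N2 g *m E'.
  by rewrite -{1}v2E' -mulmxA (horner_mx_intertwine g E'N) mulmxA.
move=> gN.
have /(congr1 (mulmx^~ P)) := gN; rewrite mulmxDl -!mulmxA PP E'P !mulmx0 addr0 mul0mx.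
rewrite -(comm_mx_horner g PA1) mulmxA vP horner_mx_subC => vg.
have /(congr1 (mulmx^~ E')) := gN; rewrite mulmxDl -!mulmxA E'E' PE' !mulmx0 add0r mul0mx.
have N2E'C : comm_mx E' N2 by rewrite /comm_mx E'N2 N2E'.
rewrite -(comm_mx_horner g N2E'C) mulmxA v2E' => v2g.
have pg : p \Po ('X + c%:P) %| g.
  have := dvdp_comp_poly ('X + c%:P) (krylov_annihilator_dvdp free sp vp vg).
  by rewrite -comp_polyA comp_polyB comp_polyX comp_polyC addrK comp_polyXr.
have p2g : p2 %| g := krylov_annihilator_dvdp free2 sp2 vp2 v2g.
have : (p \Po ('X + c%:P)) * p2 %| g by rewrite Gauss_dvdp // pg.
apply: contraTeq => g0; apply: contraL sg => /(dvdp_leq g0).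
have sX : size ('X + c%:P) = 2%N by rewrite size_XaddC.
rewrite size_mul -?size_poly_gt0 ?size_comp_poly2 ?sp ?sp2 // -ltnNge.
rewrite addSn addnS /=; apply: leq_trans.
rewrite ltnS (leq_trans _ (leq_add PrE (leqnn _))) //.
apply: leq_trans (mxrank_add _ _); rewrite /E' addrC subrK //.
Qed.

Lemma exists_cyclic_commutant (F : numClosedFieldType) (n : nat)
    (A : 'M[F]_n.+1) :
  exists (N : 'M[F]_n.+1) (v : 'rV[F]_n.+1),
    N *m A = A *m N /\ krylov N v n.+1 \in unitmx.
Proof.
have := @exists_cyclic_commutant_idempotent F n A 1%:M.
rewrite !mulmx1 mul1mx mxrank1 => /(_ erefl erefl) [N [v [NA _ _ _ /krylov_freeP]]].
by rewrite row_free_unit => Nv; exists N, v.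
Qed.

(** * Polynomial conditions along a line of matrices *)

Definition pencil (R : comNzRingType) (n : nat) (A D : 'M[R]_n) : 'M[{poly R}]_n :=
  map_mx polyC A + 'X *: map_mx polyC D.

Lemma pencil_eval (R : comNzRingType) (n : nat) (A D : 'M[R]_n) (t : R) :
  map_mx (horner_eval t) (pencil A D) = A + t *: D.
Proof.
by apply/matrixP => i j; rewrite !mxE /horner_eval !hornerE.
Qed.

Lemma map_krylov (R S : comNzRingType) (f : {rmorphism R -> S}) (n d : nat)
    (A : 'M[R]_n.+1) (v : 'rV[R]_n.+1) :
  map_mx f (krylov A v d) = krylov (map_mx f A) (map_mx f v) d.
Proof.
apply/row_matrixP => i.
by rewrite -map_row !rowK map_mxM /= rmorphXn.
Qed.

(** Being cyclic with respect to v is the nonvanishing of this polynomial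
    function of the entries of A. *)
Definition krylov_det (R : comNzRingType) (n : nat) (A : 'M[R]_n.+1)
    (v : 'rV[R]_n.+1) : R := \det (krylov A v n.+1).

Lemma map_krylov_det (R S : comNzRingType) (f : {rmorphism R -> S}) (n : nat)
    (A : 'M[R]_n.+1) (v : 'rV[R]_n.+1) :
  f (krylov_det A v) = krylov_det (map_mx f A) (map_mx f v).
Proof. by rewrite /krylov_det -map_krylov det_map_mx. Qed.

(** The polynomial q is chosen by v T = v q(A); then T and q(A), which commute
    with A, agree on all the v A^i, hence everywhere. *)
Lemma cyclic_centralizer (F : fieldType) (n : nat) (A T : 'M[F]_n.+1)
    (v : 'rV[F]_n.+1) :
  krylov_det A v != 0 -> T *m A = A *m T -> exists q, T = horner_mx A q.
Proof.
rewrite -unitfE -[_ \is a _]unitmxE => Kunit TA.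
exists (rVpoly (v *m T *m invmx (krylov A v n.+1))).
set q := rVpoly _; have vq : v *m horner_mx A q = v *m T.
  by rewrite -mul_krylov mulmxKV.
apply: (can_inj (mulKmx Kunit)); apply/row_matrixP => i.
rewrite !row_mul rowK -!mulmxA.
have comm (B : 'M_n.+1) : B *m A = A *m B -> A ^+ i *m B = B *m A ^+ i.
  by move=> BA; rewrite -{1 2}(horner_mx_X A) -!rmorphXn /=; apply/esym/comm_mx_horner.
rewrite !comm // ?mulmxA ?vq //.
by apply/comm_horner_mx.
Qed.

(** Up to sign, the discriminant of the characteristic polynomial of A: it is
    the product of its derivative at the eigenvalues. In this form it commutes
    visibly with ring morphisms, in particular with evaluation of a pencil. *)
Definition simple_spectrum_det (R : comNzRingType) (n : nat) (A : 'M[R]_n.+1) : R :=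
  \det (horner_mx A (char_poly A)^`()).

Lemma map_simple_spectrum_det (R S : comNzRingType) (f : {rmorphism R -> S}) (n : nat)
    (A : 'M[R]_n.+1) :
  f (simple_spectrum_det A) = simple_spectrum_det (map_mx f A).
Proof.
by rewrite /simple_spectrum_det -det_map_mx map_horner_mx /= -deriv_map map_char_poly.
Qed.

Lemma simple_spectrum_det_distinct (R : realType) (n : nat) (A : 'M[R[i]]_n.+1) :
  simple_spectrum_det A != 0 -> all_distinct_eigenvalues A.
Proof.
move=> simA; have [r Dp] := closed_field_poly_normal (char_poly A).
have /monicP lc1 := char_poly_monic A; rewrite lc1 scale1r in Dp.
exists r; split; last 1 first.
- by move=> a; rewrite eigenvalue_root_char Dp root_prod_XsubC.
- rewrite -separable_prod_XsubC -Dp unlock.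
  apply: Pdiv.ClosedField.root_coprimep => x px; apply: contra simA.
  rewrite -/(root _ x) /simple_spectrum_det => /factor_theorem[g ->].
  rewrite rmorphM /= -mulmxE det_mulmx rmorphB /= horner_mx_X horner_mx_C.
  rewrite mulf_eq0; apply/orP; right; move: px.
  rewrite -eigenvalue_root_char /eigenvalue /eigenspace kermx_eq0 row_free_unit.
  by rewrite unitmxE unitfE negbK.
by have := size_char_poly A; rewrite Dp size_prod_XsubC => -[].
Qed.

Lemma simple_spectrum_det_diag (F : fieldType) (n : nat) (d : 'rV[F]_n.+1) :
  injective (d 0) -> simple_spectrum_det (diag_mx d) != 0.
Proof.
move=> dinj; rewrite /simple_spectrum_det horner_mx_diag det_diag.
have Dp : char_poly (diag_mx d) =
    \prod_(z <- [seq d 0 i | i <- enum 'I_n.+1]) ('X - z%:P).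
  rewrite char_poly_trig ?diag_mx_is_trig // big_map big_enum /=.
  by apply: eq_bigr => i _; rewrite !mxE eqxx.
have sep : separable_poly (char_poly (diag_mx d)).
  by rewrite Dp separable_prod_XsubC map_inj_uniq ?enum_uniq.
apply/prodf_neq0 => i _; rewrite mxE; rewrite unlock in sep.
apply: coprimep_root sep _; rewrite Dp root_prod_XsubC.
by rewrite map_f ?mem_enum.
Qed.

(** * Estimates *)

Definition entry_norm (R : realType) (n : nat) (A : 'M[R[i]]_n) : R :=
  \sum_i \sum_j Normc.normc (A i j).

Lemma normc_ge0 (R : rcfType) (z : R[i]) : 0 <= Normc.normc z.
Proof. by case: z => a b; apply: sqrtr_ge0. Qed.

Lemma normc_sum (R : realType) (I : finType) (f : I -> R[i]) :
  Normc.normc (\sum_k f k) <= \sum_k Normc.normc (f k).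
Proof.
elim/big_ind2: _ => [|x1 x2 y1 y2 le1 le2|//]; first by rewrite Normc.normc0.
by rewrite (le_trans (le_normcD _ _)) // lerD.
Qed.

Lemma normc_le_norm2 (R : realType) (n : nat) (x : 'cV[R[i]]_n) k :
  Normc.normc (x k 0) <= norm2 x.
Proof.
rewrite /norm2 -[leLHS]ger0_norm ?normc_ge0 // -sqrtr_sqr ler_wsqrtr //.
by rewrite (bigD1 k) //= lerDl sumr_ge0 // => i _; rewrite sqr_ge0.
Qed.

Lemma norm2_le_sum (R : realType) (n : nat) (x : 'cV[R[i]]_n) :
  norm2 x <= \sum_k Normc.normc (x k 0).
Proof.
have S0 : 0 <= \sum_k Normc.normc (x k 0) by apply: sumr_ge0 => k _; apply: normc_ge0.
rewrite /norm2 -[leRHS]ger0_norm // -sqrtr_sqr ler_wsqrtr // expr2 mulr_suml.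
apply: ler_sum => k _; rewrite expr2 ler_wpM2l ?normc_ge0 //.
by rewrite (bigD1 k) //= lerDl sumr_ge0 // => i _; rewrite normc_ge0.
Qed.

Lemma spectral_norm_le_entry_norm (R : realType) (n : nat) (A : 'M[R[i]]_n) :
  spectral_norm A <= entry_norm A.
Proof.
rewrite /spectral_norm; set X := [set _ | _ in _]%classic.
have [->|/set0P X0] := eqVneq X set0.
  by rewrite sup0; do 2![apply: sumr_ge0 => ? _]; apply: normc_ge0.
apply: ge_sup X0 _ => _ [x /= x1 <-].
apply: le_trans (norm2_le_sum _) _; apply: ler_sum => i _; rewrite mxE.
apply: le_trans (normc_sum _) _; apply: ler_sum => j _.
by rewrite Normc.normcM ler_piMr ?normc_ge0 // -x1 normc_le_norm2.
Qed.

Lemma entry_normD (R : realType) (n : nat) (A B : 'M[R[i]]_n) :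
  entry_norm (A + B) <= entry_norm A + entry_norm B.
Proof.
rewrite /entry_norm -big_split; apply: ler_sum => i _.
rewrite -big_split; apply: ler_sum => j _; rewrite mxE; exact: le_normcD.
Qed.

Lemma normc_real (R : rcfType) (t : R) : 0 <= t -> Normc.normc t%:C%C = t.
Proof. by move=> t0; rewrite /= expr0n addr0 sqrtr_sqr ger0_norm. Qed.

Lemma horner_lipschitz0 (R : realType) (p : {poly R[i]}) :
  exists2 K : R, 0 <= K & forall t : R, 0 <= t <= 1 ->
    Normc.normc (p.[0] - p.[t%:C%C]) <= t * K.
Proof.
elim/poly_ind: p => [|p c [K K0 KP]].
  by exists 0 => // t _; rewrite !horner0 subrr Normc.normc0 mulr0.
exists (K + Normc.normc p.[0]) => [|t t01]; first by rewrite addr_ge0 ?normc_ge0.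
have /andP[t0 t1] := t01.
rewrite !hornerMXaddC mulr0 add0r opprD addrCA subrr addr0 normcN Normc.normcM.
rewrite normc_real // mulrC ler_wpM2l //.
rewrite -[p.[t%:C%C]](subrK p.[0]) (le_trans (le_normcD _ _)) // lerD2r.
rewrite -normcN opprB (le_trans (KP t t01)) // ler_piMl //.
Qed.

(** The nonzero polynomial p excludes finitely many values of the parameter,
    and the entries of P are Lipschitz at 0. *)
Lemma exists_small_nonroot (R : realType) (n : nat) (P : 'M[{poly R[i]}]_n)
    (p : {poly R[i]}) (eps : R) :
  p != 0 -> 0 < eps ->
  exists2 t : R, p.[t%:C%C] != 0 &
    entry_norm (map_mx (horner_eval 0) P - map_mx (horner_eval t%:C%C) P) < eps.
Proof.
move=> p0 eps0.
have [K KP] : exists K : 'I_n -> 'I_n -> R, forall i j, 0 <= K i j /\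
    forall t : R, 0 <= t <= 1 ->
      Normc.normc ((P i j).[0] - (P i j).[t%:C%C]) <= t * K i j.
  have /choice[K KP] : forall ij : 'I_n * 'I_n, exists K : R, 0 <= K /\
      forall t : R, 0 <= t <= 1 ->
        Normc.normc ((P ij.1 ij.2).[0] - (P ij.1 ij.2).[t%:C%C]) <= t * K.
    by move=> [i j]; have [K] := horner_lipschitz0 (P i j); exists K.
  by exists (fun i j => K (i, j)) => i j; apply: (KP (i, j)).
pose L := \sum_i \sum_j K i j.
have L0 : 0 <= L by do 2![apply: sumr_ge0 => ? _]; apply: (KP _ _).1.
(* L + 1 instead of L, since L may be zero. *)
pose e := Num.min 1 (eps / (L + 1)).
have e0 : 0 < e by rewrite lt_min ltr01 divr_gt0 // ltr_wpDl.
pose f (k : nat) : R := e / k.+1%:R.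
have finj : injective f.
  by move=> k l /(mulfI (lt0r_neq0 e0))/invr_inj/eqP; rewrite eqr_nat => /eqP[].
have f0 k : 0 <= f k by rewrite divr_ge0 // ltW.
have fe k : f k <= e by rewrite ler_pdivrMr ?ltr0n // ler_peMr ?ler1n ?(ltW e0).
have [k pk] : exists k, ~~ root p (f k)%:C%C.
  by apply: (exists_nonroot (f := fun k => (f k)%:C%C)) => // i j [/finj].
exists (f k) => //.
have f01 : 0 <= f k <= 1 by rewrite f0 (le_trans (fe k)) // ge_min lexx.
apply: (@le_lt_trans _ _ (f k * L)).
  rewrite /entry_norm /L mulr_sumr; apply: ler_sum => i _.
  rewrite mulr_sumr; apply: ler_sum => j _; rewrite !mxE.
  exact: (KP i j).2.
apply: (@le_lt_trans _ _ (eps / (L + 1) * L)).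
  by rewrite ler_wpM2r // (le_trans (fe k)) // ge_min lexx orbT.
rewrite -mulrA gtr_pMr // mulrC ltr_pdivrMr ?ltr_wpDl // mul1r ltrDl //.
Qed.

(** * Matrices that are normal for an involution *)

Lemma conjC_real (R : rcfType) (t : R) : (t%:C%C)^* = t%:C%C.
Proof. by rewrite [LHS]/(t%:C%C^*)%C /= oppr0. Qed.

Section Involution.
Variables (R : realType) (n : nat).
Local Notation C := R[i].
Variable star : 'M[C]_n.+1 -> 'M[C]_n.+1.
Hypothesis starD : forall A B, star (A + B) = star A + star B.
Hypothesis starZ : forall a A, star (a *: A) = a^* *: star A.
Hypothesis starM : forall A B, star (A *m B) = star B *m star A.
Hypothesis starK : involutive star.

Let starB A B : star (A - B) = star A - star B.
Proof. by rewrite -scaleN1r starD starZ rmorphN1 scaleN1r. Qed.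

Let star_line A B (t : R) : star A = A -> star B = B ->
  star (A + t%:C%C *: B) = A + t%:C%C *: B.
Proof. by move=> sA sB; rewrite starD starZ conjC_real sA sB. Qed.

Let star_comm A B : star B = B -> A *m B = B *m A -> star A *m B = B *m star A.
Proof. by move=> sB AB; rewrite -{1}sB -starM -AB starM sB. Qed.

Let comm_line (A B T : 'M[C]_n.+1) (a : C) :
  A *m T = T *m A -> B *m T = T *m B -> (A + a *: B) *m T = T *m (A + a *: B).
Proof. by move=> AT BT; rewrite mulmxDl mulmxDr -scalemxAl -scalemxAr AT BT. Qed.

(** Since g(W) commutes with W = W^*, so does g(W)^*, which therefore commutes
    with every polynomial in W. *)
Lemma horner_star_normal (W : 'M[C]_n.+1) (g : {poly C}) : star W = W ->
  let A := horner_mx W g in A *m star A = star A *m A.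
Proof.
move=> sW A; apply/esym/comm_mx_horner/star_comm => //.
exact: comm_horner_mx.
Qed.

Let re A := A + star A.
Let im A := 'i *: (A - star A).

Let star_re A : star (re A) = re A.
Proof. by rewrite /re starD starK addrC. Qed.

Let star_im A : star (im A) = im A.
Proof. by rewrite /im starZ starB starK conjCi scaleNr -scalerN opprB. Qed.

Let re_im A : A = 2^-1 *: re A - ('i / 2) *: im A.
Proof.
rewrite /re /im scalerA mulrAC -expr2 sqrCi mulN1r scaleNr opprK -scalerDr.
by rewrite addrACA subrr addr0 -mulr2n -(scaler_nat 2 A) scalerA
  mulVf ?scale1r // pnatr_eq0.
Qed.

Let comm_re A B : star B = B -> A *m B = B *m A -> re A *m B = B *m re A.
Proof. by move=> sB AB; rewrite mulmxDl mulmxDr AB star_comm. Qed.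

Let comm_im A B : star B = B -> A *m B = B *m A -> im A *m B = B *m im A.
Proof.
by move=> sB AB; rewrite -scalemxAl -scalemxAr mulmxBl mulmxBr AB star_comm.
Qed.

(** The selfadjoint parts X and Y of a cyclic N commuting with T commute with T
    too, and the pencil X + t Y, cyclic at t = -i/2, is cyclic at some natural
    number t. *)
Lemma exists_cyclic_selfadjoint_commutant (T : 'M[C]_n.+1) : star T = T ->
  exists (Z : 'M[C]_n.+1) (v : 'rV[C]_n.+1),
    [/\ star Z = Z, Z *m T = T *m Z & krylov_det Z v != 0].
Proof.
move=> sT; have [N [v [NT Nv]]] := exists_cyclic_commutant T.
pose X : 'M[C]_n.+1 := (2^-1 : R)%:C%C *: re N; pose Y := im N.
pose p := krylov_det (pencil X Y) (map_mx polyC v).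
have pE (t : C) : p.[t] = krylov_det (X + t *: Y) v.
  rewrite -/(horner_eval t p) /p map_krylov_det pencil_eval -map_mx_comp.
  by congr (krylov_det _ _); apply/matrixP => i j; rewrite !mxE /= /horner_eval hornerC.
(* N = X - (i/2) Y is cyclic. *)
have p0 : p != 0.
  have : p.[- ('i / 2)] != 0.
    have -> : p.[- ('i / 2)] = krylov_det N v.
      by rewrite pE scaleNr /X fmorphV rmorph_nat -re_im.
    by rewrite -unitfE -[_ \is a _]unitmxE.
  by apply: contraNneq => ->; rewrite horner0.
have [k pk] : exists k : nat, ~~ root p k%:R.
  by apply: exists_nonroot p0; apply: mulrIn; rewrite oner_eq0.
have kR : k%:R = (k%:R : R)%:C%C :> C by rewrite rmorph_nat.
exists (X + k%:R *: Y), v; split.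
- by rewrite kR star_line ?star_im // /X starZ conjC_real star_re.
- apply: comm_line; last exact: comm_im.
  by rewrite -scalemxAl -scalemxAr comm_re.
- by rewrite -pE.
Qed.

(** The far end D of the second segment: a single selfadjoint matrix with
    distinct eigenvalues makes distinct eigenvalues generic among the
    selfadjoint ones. *)
Lemma star_normal_approx (D A : 'M[C]_n.+1) (eps : R) :
  star D = D -> simple_spectrum_det D != 0 -> A *m star A = star A *m A -> 0 < eps ->
  exists B : 'M[C]_n.+1, [/\ B *m star B = star B *m B,
    all_distinct_eigenvalues B & entry_norm (A - B) < eps].
Proof.
move=> sD Dsimple nA eps0.
have eps3 : 0 < eps / 3 by rewrite divr_gt0 // ltr0n.
pose S : 'M[C]_n.+1 := (2^-1 : R)%:C%C *: re A; pose T := im A.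
have sS : star S = S by rewrite /S starZ conjC_real star_re.
have AST : A = S - ('i / 2) *: T.
  by rewrite {1}(re_im A) /S fmorphV rmorph_nat.
have ST : S *m T = T *m S.
  rewrite /S -scalemxAl -(scalemxAr _ T); congr (_ *: _); apply/esym/comm_im => //.
  by rewrite mulmxDr mulmxDl nA.
have sT : star T = T by apply: star_im.
clearbody S T.
have [Z [v [sZ ZT Zv]]] := exists_cyclic_selfadjoint_commutant sT.
have pencil0 (X Y : 'M[C]_n.+1) : map_mx (horner_eval 0) (pencil X Y) = X.
  by rewrite pencil_eval scale0r addr0.
have pencil1 (X Y : 'M[C]_n.+1) : map_mx (horner_eval 1) (pencil X (Y - X)) = Y.
  by rewrite pencil_eval scale1r addrC subrK.
have neq0 (p : {poly C}) t : horner_eval t p != 0 -> p != 0.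
  by apply: contraNneq => ->; rewrite rmorph0.
have vE (t : C) : map_mx (horner_eval t) (map_mx polyC v) = v.
  by apply/matrixP => i j; rewrite !mxE /= /horner_eval hornerC.
have gE (t : C) (g : {poly C}) : map_poly (horner_eval t) (map_poly polyC g) = g.
  by apply/polyP => i; rewrite !coef_map /= /horner_eval hornerC.
(* First segment: make T a polynomial in the selfadjoint part. *)
pose p1 := krylov_det (pencil S (Z - S)) (map_mx polyC v).
have p1_neq0 : p1 != 0.
  by apply: (neq0 _ 1); rewrite map_krylov_det pencil1 vE.
have [t1 t1P small1] := exists_small_nonroot (pencil A (Z - S)) p1_neq0 eps3.
pose W := S + t1%:C%C *: (Z - S).
have sW : star W = W by apply: star_line => //; rewrite starB sZ sS.
have Wv : krylov_det W v != 0.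
  by move: t1P; rewrite -/(horner_eval _ _) map_krylov_det pencil_eval vE.
have TW : T *m W = W *m T.
  by apply/esym/comm_line; rewrite // mulmxBl mulmxBr ST ZT.
have [q Tq] := cyclic_centralizer Wv TW.
pose g := 'X - ('i / 2) *: q.
have gW : A + t1%:C%C *: (Z - S) = horner_mx W g.
  by rewrite rmorphB /= linearZ /= -Tq horner_mx_X {1}AST addrAC.
rewrite pencil0 pencil_eval gW in small1.
clearbody W g.
(* Second segment: separate the eigenvalues of W, keeping g. *)
have p2_neq0 : simple_spectrum_det (pencil W (D - W)) != 0.
  by apply: (neq0 _ 1); rewrite map_simple_spectrum_det pencil1.
have [t2 t2P small2] :=
  exists_small_nonroot (horner_mx (pencil W (D - W)) (map_poly polyC g)) p2_neq0 eps3.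
pose W' := W + t2%:C%C *: (D - W).
have sW' : star W' = W' by apply: star_line => //; rewrite starB sD sW.
have W'simple : simple_spectrum_det W' != 0.
  by move: t2P; rewrite -/(horner_eval _ _) map_simple_spectrum_det pencil_eval.
rewrite !map_horner_mx /= !gE pencil0 pencil_eval -/W' in small2.
clearbody W'.
(* Third segment: g may identify eigenvalues of W', so move g(W') towards W'. *)
set B0 := horner_mx W' g in small2.
have p3_neq0 : simple_spectrum_det (pencil B0 (W' - B0)) != 0.
  by apply: (neq0 _ 1); rewrite map_simple_spectrum_det pencil1.
have [t3 t3P small3] := exists_small_nonroot (pencil B0 (W' - B0)) p3_neq0 eps3.
rewrite pencil0 pencil_eval in small3.
rewrite -/(horner_eval _ _) map_simple_spectrum_det pencil_eval in t3P.
exists (B0 + t3%:C%C *: (W' - B0)); split.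
- have -> : B0 + t3%:C%C *: (W' - B0) = horner_mx W' (g + t3%:C%C *: ('X - g)).
    by rewrite rmorphD /= linearZ /= rmorphB /= horner_mx_X.
  exact: horner_star_normal.
- exact: simple_spectrum_det_distinct.
have -> : A - (B0 + t3%:C%C *: (W' - B0)) = (A - horner_mx W g) +
    (horner_mx W g - B0) + (B0 - (B0 + t3%:C%C *: (W' - B0))).
  by rewrite !addrA subrK subrK.
apply: le_lt_trans (entry_normD _ _) _.
apply: le_lt_trans (lerD (entry_normD _ _) (lexx _)) _.
have -> : eps = eps / 3 + eps / 3 + eps / 3
  by rewrite -!mulrDl -mulr2n -mulrSr -(mulr_natr eps 3) mulfK // pnatr_eq0.
by rewrite !ltrD.
Qed.

End Involution.

(** * The adjoint with respect to J *)

Section JAdjoint.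
Local Open Scope sesquilinear_scope.

Lemma Jmx_sqr (R : realType) m : Jmx R m *m Jmx R m = - 1%:M.
Proof.
rewrite /Jmx mulmx_block !mul0mx !mulmx0 !mul1mx !mulmx1 !(add0r, addr0).
by rewrite scalar_mx_block opp_block_mx oppr0.
Qed.

Lemma Jmx_unit (R : realType) m : Jmx R m \in unitmx.
Proof.
by have /mulmx1_unit[] : Jmx R m *m - Jmx R m = 1%:M by rewrite mulmxN Jmx_sqr opprK.
Qed.

Lemma invmx_Jmx (R : realType) m : invmx (Jmx R m) = - Jmx R m.
Proof.
apply: (can_inj (mulKmx (Jmx_unit R m))).
by rewrite mulmxV ?Jmx_unit // mulmxN Jmx_sqr opprK.
Qed.

Lemma Jmx_adjoint (R : realType) m : (Jmx R m) ^t* = - Jmx R m.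
Proof.
rewrite /Jmx tr_block_mx map_block_mx opp_block_mx !trmx0 !map_mx0 oppr0.
by rewrite linearN /= trmx1 map_mxN map_mx1 opprK.
Qed.

Lemma JstarD (R : realType) m (A B : 'M[R[i]]_(m + m)) :
  Jstar (A + B) = Jstar A + Jstar B.
Proof. by rewrite /Jstar linearD map_mxD mulmxDr mulmxDl. Qed.

Lemma JstarZ (R : realType) m (a : R[i]) (A : 'M[R[i]]_(m + m)) :
  Jstar (a *: A) = a^* *: Jstar A.
Proof. by rewrite /Jstar linearZ map_mxZ -scalemxAr -scalemxAl. Qed.

Lemma JstarM (R : realType) m (A B : 'M[R[i]]_(m + m)) :
  Jstar (A *m B) = Jstar B *m Jstar A.
Proof.
by rewrite /Jstar trmx_mul map_mxM !mulmxA mulmxK ?Jmx_unit.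
Qed.

Lemma JstarK (R : realType) m : involutive (@Jstar R m).
Proof.
move=> A; rewrite /Jstar invmx_Jmx !trmx_mul !map_mxM trmxCK.
rewrite linearN map_mxN Jmx_adjoint opprK.
rewrite !(mulNmx, mulmxN) opprK !mulmxA Jmx_sqr -mulmxA Jmx_sqr.
by rewrite !(mulNmx, mulmxN) mul1mx mulmx1 opprK.
Qed.

Lemma block_mx_conj_symplectic (R : pzRingType) (m : nat) (X Y : 'M[R]_m) :
  let J := block_mx 0 1%:M (- 1%:M) 0 in
  - (J *m block_mx X 0 0 Y *m J) = block_mx Y 0 0 X.
Proof.
rewrite /= !mulmx_block !mul0mx !mulmx0 !mul1mx !mulNmx !mul1mx.
rewrite !add0r !addr0 !mulmxN !mulmx1 oppr0.
by rewrite opp_block_mx !opprK oppr0.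
Qed.

(** A diagonal matrix is J-selfadjoint when its second half is the conjugate of
    its first; purely imaginary entries make the two halves disjoint. *)
Definition imaginary_spectrum (R : realType) m : 'rV[R[i]]_(m + m) :=
  row_mx (\row_(k < m) (k.+1%:R * 'i)) (\row_(k < m) - (k.+1%:R * 'i)).

Lemma Jstar_diag_imaginary (R : realType) m :
  Jstar (diag_mx (imaginary_spectrum R m)) = diag_mx (imaginary_spectrum R m).
Proof.
rewrite /Jstar invmx_Jmx tr_diag_mx map_diag_mx /imaginary_spectrum map_row_mx.
have conjE (k : nat) : (k.+1%:R * 'i)^* = - (k.+1%:R * 'i) :> R[i].
  by rewrite rmorphM /= rmorph_nat conjCi mulrN.
set a := \row_k _; set b := \row_k _.
have -> : a ^ Num.conj = b by apply/rowP => k; rewrite !mxE conjE.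
have -> : b ^ Num.conj = a by apply/rowP => k; rewrite !mxE -conjE conjCK.
by rewrite !diag_mx_row mulNmx mulNmx block_mx_conj_symplectic.
Qed.

Lemma imaginary_spectrum_inj (R : realType) m :
  injective (imaginary_spectrum R m 0).
Proof.
move=> i j; rewrite /imaginary_spectrum.
have neq (k l : nat) : k.+1%:R * 'i <> - (l.+1%:R * 'i) :> R[i].
  move/eqP; rewrite -subr_eq0 opprK -mulrDl -natrD mulf_eq0 (negPf (neq0Ci _)) orbF.
  by rewrite pnatr_eq0.
case: (split_ordP i) => k ->; case: (split_ordP j) => l ->;
  rewrite !(row_mxEl, row_mxEr) !mxE.
- by move=> /(mulIf (neq0Ci _))/eqP; rewrite eqr_nat => /eqP[/val_inj->].
- by move/neq.
- by move/esym/neq.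
by move=> /oppr_inj/(mulIf (neq0Ci _))/eqP; rewrite eqr_nat => /eqP[/val_inj->].
Qed.

End JAdjoint.

(** * Density of distinct eigenvalues *)

Theorem theorem9 (R : realType) (m : nat) (A : 'M[R[i]]_(m + m)) (eps : R)
    (hA : Jnormal A) (heps : 0 < eps) :
  exists Ahat : 'M[R[i]]_(m + m),
    [/\ Jnormal Ahat,
        all_distinct_eigenvalues Ahat
      & spectral_norm (A - Ahat) < eps].
Proof.
(* For m = 0 there are no eigenvalues to separate. *)
case: m => [|m] in A hA *.
  exists A; split=> //.
    exists [::]; split=> // a; rewrite /eigenvalue [eigenspace _ _]flatmx0.
    by rewrite eqxx.
  apply: le_lt_trans (spectral_norm_le_entry_norm _) _.
  by rewrite /entry_norm big_ord0.
have [B [nB simpleB AB]] := star_normal_approx (@JstarD R m.+1) (@JstarZ R m.+1)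
  (@JstarM R m.+1) (@JstarK R m.+1) (Jstar_diag_imaginary R m.+1)
  (simple_spectrum_det_diag (@imaginary_spectrum_inj R m.+1)) hA heps.
exists B; split=> //.
exact: le_lt_trans (spectral_norm_le_entry_norm _) AB.
Qed.
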